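(* Let $x>0$. For any $\lambda\in\Lambda(x)$, $$\dim_{\mathrm H}\bigl(\Lambda(x)\bigr)=\dim_{\mathrm H}E_\lambda=\frac{\log 2}{\log 3}.$$
   Context: For $\lambda>0$, $E_\lambda$ denotes the self-similar set generated by the iterated function system $\{f_0(t)=t/3,\ f_1(t)=(t+\lambda)/3\}$ on $\mathbb{R}$; equivalently $E_\lambda=\left\{\sum_{i=1}^\infty d_i/3^i : d_i\in\{0,\lambda\}\right\}=\frac{\lambda}{2}C_{1/3}$, where $C_{1/3}$ is the middle-third Cantor set. For $x>0$, $\Lambda(x)=\{\lambda>0 : x\in E_\lambda\}$. $\dim_{\mathrm H}$ denotes Hausdorff dimension. *)

(* Defs.v *)
From mathcomp Require Import all_boot all_order all_algebra.
From mathcomp Require Import all_classical all_reals all_analysis.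

Set Implicit Arguments.
Unset Strict Implicit.
Unset Printing Implicit Defensive.

Import Order.TTheory GRing.Theory Num.Theory.
Import numFieldNormedType.Exports.

Local Open Scope classical_set_scope.
Local Open Scope ring_scope.

Section Hausdorff.
Context {R : realType}.
Implicit Types (A U : set R) (s delta : R).

(* [0] is added to the set of distances so that the empty set has diameter 0
   rather than -oo. *)
Definition diam U : \bar R :=
  ereal_sup (0%:E |` [set `|p.1 - p.2|%:E | p in U `*` U]).

(* [x `^ 0 = 1] for every [x], including 0. Nonempty sets thus have weight 1
   for s = 0, and the empty set has to be singled out: it has weight 0 for
   every s, so that finite covers are among the countable ones. *)
Definition hausdorff_weight s U : \bar R :=
  if U == set0 then 0%E else (diam U `^ s)%E.

Definition delta_cover delta A (U : nat -> set R) : Prop :=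
  A `<=` \bigcup_k U k /\ forall k, (diam (U k) <= delta%:E)%E.

Definition hausdorff_content s delta A : \bar R :=
  ereal_inf [set (\sum_(0 <= k <oo) hausdorff_weight s (U k))%E
            | U in delta_cover delta A].

Definition hausdorff_measure s A : \bar R :=
  ereal_sup [set hausdorff_content s delta A | delta in [set d : R | 0 < d]].

Definition hausdorff_dim A : \bar R :=
  ereal_inf [set s%:E | s in [set s : R | 0 <= s /\
                                 hausdorff_measure s A = 0%E]].

End Hausdorff.

Section SelfSimilar.
Context {R : realType}.

Definition is_self_similar_set (I : Type) (f : I -> R -> R) (K : set R) : Prop :=
  [/\ compact K, K !=set0 & K = \bigcup_i (f i @` K)].

(* For an iterated function system of finitely many contractions there is
   exactly one such K (Hutchinson), so that [xget] selects it. *)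
Definition self_similar_set (I : Type) (f : I -> R -> R) : set R :=
  xget set0 (is_self_similar_set f).

Definition ifs (lambda : R) (i : bool) (t : R) : R :=
  if i then (t + lambda) / 3 else t / 3.

Definition E (lambda : R) : set R := self_similar_set (ifs lambda).

Definition Lambda (x : R) : set R := [set lambda | 0 < lambda /\ E lambda x].

End SelfSimilar.

(* Main.v *)
Require Import Defs.
From mathcomp Require Import all_boot all_order all_algebra.
From mathcomp Require Import all_classical all_reals all_analysis.
From mathcomp Require Import ring lra.
Import Order.TTheory GRing.Theory Num.Theory.
Import numFieldNormedType.Exports.
Local Open Scope classical_set_scope.
Local Open Scope ring_scope.

(** Up to the factor lambda, [E lambda] is the set of ternary expansions with
    digits 0 and 1, so lambda is in [Lambda x] if and only if x / lambda is in
    [E 1]. The inversion lambda |-> x / lambda is bi-Lipschitz on compact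
    subsets of the positive half-line, hence [Lambda x] inherits both bounds on
    the dimension. Upper bound: [E 1] is covered by 2^n sets of diameter
    O(3^-n), and [Lambda x] is a countable union of inverse-Lipschitz copies of
    subsets of [E 1]. Lower bound: reading a sequence of digits in base 2
    instead of base 3 is Hoelder of exponent ln 2 / ln 3 and maps onto [0, 1], so
    that countable subadditivity of the Lebesgue measure bounds from below the
    weight of every cover. *)

(** * Geometric convergence and 0-1 expansions in powers of q *)

Section Geometric.
Context {R : realType}.
Implicit Types (C e q y z : R) (w : nat -> bool).

Lemma geometric_lt C e q : 0 <= q < 1 -> 0 < e -> exists n, C * q ^+ n < e.
Proof.
move=> /andP[q0 q1] e0.
have q1' : `|q| < 1 by rewrite ger0_norm.
have /cvgrPdist_lt /(_ _ e0) [n _ /(_ n (leqnn n))] := cvg_geometric C q1'.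
rewrite /geometric /= sub0r normrN => h; exists n.
exact: le_lt_trans (ler_norm _) h.
Qed.

Lemma eq_geometric C q y z : 0 <= q < 1 ->
  (forall n, `|y - z| <= C * q ^+ n) -> y = z.
Proof.
move=> q01 h; apply/eqP; rewrite -subr_eq0 -normr_eq0; apply/negPn/negP => ne0.
have e0 : 0 < `|y - z| by rewrite lt_def ne0 /=.
have [n] := geometric_lt C _ _ q01 e0.
by rewrite ltNge h.
Qed.

Lemma closed_geometric (K : set R) C q y : closed K -> 0 <= q < 1 ->
  (forall n, exists2 z, K z & `|y - z| <= C * q ^+ n) -> K y.
Proof.
move=> cK q01 h; apply: cK => B /nbhs_ballP[e /= e0 eB].
have [n ne] := geometric_lt C _ _ q01 e0.
have [z Kz yz] := h n.
by exists z; split => //; apply: eB; rewrite /ball /=; exact: le_lt_trans ne.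
Qed.

Definition stail w : nat -> bool := fun i => w i.+1.

Definition scons (b : bool) w : nat -> bool :=
  fun i => if i is i'.+1 then w i' else b.

Definition expansion q w : R := limn (series (fun i => (w i)%:R * q ^+ i.+1)).

Lemma is_cvg_expansion q w : 0 <= q < 1 ->
  cvgn (series (fun i => (w i)%:R * q ^+ i.+1)).
Proof.
move=> /andP[q0 q1].
apply: (@series_le_cvg _ _ (geometric q q)) => [n|n|n|].
- by rewrite mulr_ge0// exprn_ge0.
- by rewrite /geometric /= mulr_ge0// exprn_ge0.
- rewrite /geometric /= exprS ler_piMl ?mulr_ge0 ?exprn_ge0//.
  by case: (w n).
- by apply: is_cvg_geometric_series; rewrite ger0_norm.
Qed.

Lemma expansion_ge0 q w : 0 <= q < 1 -> 0 <= expansion q w.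
Proof.
move=> q01; apply: limr_ge; first exact: is_cvg_expansion.
near=> n; rewrite /series /=; apply: sumr_ge0 => i _.
by rewrite mulr_ge0// exprn_ge0//; case/andP: q01.
Unshelve. all: by end_near. Qed.

Lemma expansion_le q w : 0 <= q < 1 -> expansion q w <= q / (1 - q).
Proof.
move=> q01; have /andP[q0 q1] := q01.
have q1' : `|q| < 1 by rewrite ger0_norm.
have h := @cvg_geometric_series R q q q1'.
rewrite -(cvg_lim _ h)//; apply: ler_lim.
- exact: is_cvg_expansion.
- by apply/cvg_ex; exists (q / (1 - q)).
near=> n; rewrite /series /=; apply: ler_sum => i _.
rewrite /geometric /= exprS ler_piMl ?mulr_ge0 ?exprn_ge0//.
by case: (w i).
Unshelve. all: by end_near. Qed.

Lemma expansionE q w : 0 <= q < 1 ->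
  expansion q w = q * ((w 0%N)%:R + expansion q (stail w)).
Proof.
move=> q01; rewrite {1}/expansion; apply: cvg_lim => //.
rewrite -cvg_shiftS.
have -> : [sequence series (fun i => (w i)%:R * q ^+ i.+1) n.+1]_n =
   (fun n => q * ((w 0%N)%:R + series (fun i => (stail w i)%:R * q ^+ i.+1) n)).
  apply/funext => n; rewrite /series /= big_nat_recl// mulrDr expr1 mulrC.
  congr (_ + _); rewrite big_distrr /=; apply: eq_bigr => i _.
  by rewrite /stail [q ^+ i.+2]exprS; ring.
apply: cvgMr; apply: cvgD; first exact: cvg_cst.
exact: is_cvg_expansion.
Qed.

End Geometric.

(** * Comparison of base 2 and base 3 readings of a digit sequence *)

Section Digits.
Context {R : realType}.
Implicit Types (y : R) (w : nat -> bool).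

Lemma half_bounds : 0 <= (2^-1 : R) < 1.
Proof. by apply/andP; split; lra. Qed.

Lemma third_bounds : 0 <= (3^-1 : R) < 1.
Proof. by apply/andP; split; lra. Qed.

Lemma expansion_half w : 0 <= expansion (2^-1 : R) w <= 1.
Proof.
rewrite expansion_ge0 ?half_bounds//=.
have e : (2^-1 : R) / (1 - 2^-1) = 1 by field.
by have := expansion_le _ w half_bounds; rewrite e.
Qed.

Lemma expansion_third w : 0 <= expansion (3^-1 : R) w <= 2^-1.
Proof.
rewrite expansion_ge0 ?third_bounds//=.
have e : (3^-1 : R) / (1 - 3^-1) = 2^-1 by field.
by have := expansion_le _ w third_bounds; rewrite e.
Qed.

(** The doubling map modulo 1, except that 1 is fixed instead of sent to 0: [0, 1] is thus stable
    and 1 gets the expansion with all digits 1. *)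
Definition doubling y : R := if 2^-1 <= y then 2 * y - 1 else 2 * y.

Definition binary_digits y : nat -> bool := fun i => 2^-1 <= iter i doubling y.

(** One step of [doubling] shifts the digits and doubles the error, while the error never exceeds 1
    on [0, 1]; after n steps back it is at most 2^-n. *)
Lemma expansion_binary_digits y : 0 <= y <= 1 ->
  expansion 2^-1 (binary_digits y) = y.
Proof.
move=> y01; apply: (@eq_geometric _ 1 2^-1); first exact: half_bounds.
move=> n; rewrite mul1r; elim: n y y01 => [|n IH] y y01.
  have /andP[? ?] := expansion_half (binary_digits y).
  by rewrite expr0 ler_norml; apply/andP; split; lra.
rewrite expansionE; last exact: half_bounds.
have -> : stail (binary_digits y) = binary_digits (doubling y).
  by apply/funext => i; rewrite /stail /binary_digits iterSr.
have d01 : 0 <= doubling y <= 1.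
  by rewrite /doubling; case: ifPn => h; apply/andP; split; lra.
have := IH _ d01; set u := expansion _ _ => h.
have -> : 2^-1 * ((binary_digits y 0)%:R + u) - y = 2^-1 * (u - doubling y).
  by rewrite /binary_digits /doubling /=; case: ifPn => _ /=; field.
by rewrite normrM exprS ger0_norm// ler_pM2l.
Qed.

Lemma expansion_scons q (b : bool) w : 0 <= q < 1 ->
  expansion q (scons b w) = q * (b%:R + expansion q w) :> R.
Proof. by move=> q01; rewrite expansionE. Qed.

(** The base 3 values lie one in [0, 1/6] and the other in [1/3, 1/2], hence a gap of at least 1/6
    and the constant 6. *)
Lemma expansion_separation0 w w' : w 0%N != w' 0%N ->
  exists n, (3^-1 : R) ^+ n <= 6 * `|expansion 3^-1 w - expansion 3^-1 w'| /\
            `|expansion 2^-1 w - expansion 2^-1 w'| <= (2^-1 : R) ^+ n.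
Proof.
move=> ww'; exists 0%N; rewrite !expr0.
have /andP[? ?] := expansion_third (stail w).
have /andP[? ?] := expansion_third (stail w').
have /andP[? ?] := expansion_half w.
have /andP[? ?] := expansion_half w'.
rewrite (@expansionE R 3^-1 w) ?(@expansionE R 3^-1 w') ?third_bounds//.
split; last first.
  by rewrite ler_norml; apply/andP; split; lra.
case: (w 0%N) (w' 0%N) ww' => [] [] //= _.
  by rewrite ger0_norm; lra.
by rewrite ler0_norm; lra.
Qed.

(* n is the first rank at which w and w' differ. *)
Lemma expansion_separation w w' : w <> w' ->
  exists n, (3^-1 : R) ^+ n <= 6 * `|expansion 3^-1 w - expansion 3^-1 w'| /\
            `|expansion 2^-1 w - expansion 2^-1 w'| <= (2^-1 : R) ^+ n.
Proof.
move=> ww'.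
have [n nP] : exists n, w n != w' n.
  apply/not_existsP => h; apply: ww'; apply/funext => n.
  by apply/eqP/negPn/negP/h.
(* The induction runs on any rank of disagreement. Equal first digits cancel, and passing to tails
   multiplies the distances by 3 and 2; otherwise rank 0 already separates. *)
elim: n w w' nP {ww'} => [|n IH] w w' nP; last first.
  have [e|e] := eqVneq (w 0%N) (w' 0%N); last exact: expansion_separation0.
  have [m [h1 h2]] := IH (stail w) (stail w') nP.
  exists m.+1; rewrite (@expansionE R 3^-1 w) ?(@expansionE R 3^-1 w')
    ?third_bounds//.
  rewrite (@expansionE R 2^-1 w) ?(@expansionE R 2^-1 w') ?half_bounds// e.
  have aux q (c a b : R) : q * (c + a) - q * (c + b) = q * (a - b) by ring.
  rewrite !aux !normrM !exprS !(@ger0_norm _ _^-1)//.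
  split; last by rewrite ler_pM2l.
  by rewrite mulrCA ler_pM2l.
exact: expansion_separation0.
Qed.
End Digits.

(** * Sets of Hausdorff measure zero *)

Section HausdorffNull.
Context {R : realType}.
Implicit Types (A B U : set R) (s t d e : R).

Lemma diam_ge0 U : (0 <= diam U)%E.
Proof. by apply: ereal_sup_ubound; left. Qed.

Lemma dist_le_diam U y z : U y -> U z -> (`|y - z|%:E <= diam U)%E.
Proof. by move=> Uy Uz; apply: ereal_sup_ubound; right; exists (y, z). Qed.

Lemma diam_le U d : 0 <= d -> (forall y z, U y -> U z -> `|y - z| <= d) ->
  (diam U <= d%:E)%E.
Proof.
move=> d0 h; apply: ge_ereal_sup => _ [->|[[y z] [/= Uy Uz] <-]].
  by rewrite lee_fin.
by rewrite lee_fin h.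
Qed.

Lemma hausdorff_weight_ge0 s U : (0 <= hausdorff_weight s U)%E.
Proof. by rewrite /hausdorff_weight; case: ifP => // _; exact: poweR_ge0. Qed.

Lemma hausdorff_weight_le s U d : 0 <= s -> (diam U <= d%:E)%E ->
  (hausdorff_weight s U <= (d `^ s)%:E)%E.
Proof.
move=> s0 Ud; rewrite /hausdorff_weight; case: ifP => _.
  by rewrite lee_fin powR_ge0.
have := diam_ge0 U; case: (diam U) Ud => // r.
rewrite poweR_EFin !lee_fin => rd r0.
by apply: ge0_ler_powR => //; rewrite nnegrE// (le_trans r0).
Qed.

Lemma hausdorff_content_ge0 s d A : (0 <= hausdorff_content s d A)%E.
Proof.
apply: le_ereal_inf_tmp => _ [U _ <-].
by apply: nneseries_ge0 => n _ _; exact: hausdorff_weight_ge0.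
Qed.

Lemma hausdorff_measure_eq0P s A : hausdorff_measure s A = 0%E <->
  forall d e, 0 < d -> 0 < e -> exists2 U, delta_cover d A U &
    (\sum_(0 <= k <oo) hausdorff_weight s (U k) <= e%:E)%E.
Proof.
split => [h d e d0 e0|h].
  have : (hausdorff_content s d A < e%:E)%E.
    apply: (@le_lt_trans _ _ 0%E); last by rewrite lte_fin.
    by rewrite -h; apply: ereal_sup_ubound; exists d.
  by move=> /ereal_inf_lt[_ [U dU <-]] /ltW; exists U.
apply/eqP; rewrite eq_le; apply/andP; split.
  apply: ge_ereal_sup => _ [d d0 <-]; apply/lee_addgt0Pr => e e0.
  by have [U dU Ue] := h d e d0 e0; rewrite add0e;
    apply: (le_trans (ereal_inf_lbound _) Ue); exists U.
apply: (le_trans (hausdorff_content_ge0 s 1 A)).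
by apply: ereal_sup_ubound; exists 1 => //=.
Qed.

Lemma hausdorff_measure0_bigcup s A (F : nat -> set R) :
  A `<=` \bigcup_m F m -> (forall m, hausdorff_measure s (F m) = 0%E) ->
  hausdorff_measure s A = 0%E.
Proof.
move=> AF F0; apply/hausdorff_measure_eq0P => d e d0 e0.
pose P m (U : nat -> set R) := delta_cover d (F m) U /\
  (\sum_(0 <= k <oo) hausdorff_weight s (U k) <= (e / (2 ^ m.+1)%:R)%:E)%E.
have [G GP] : {G : nat -> nat -> set R & forall m, P m (G m)}.
  apply: (@choice _ _ P) => m.
  have /hausdorff_measure_eq0P/(_ d (e / (2 ^ m.+1)%:R) d0) := F0 m.
  by case=> [|U ? ?]; [rewrite divr_gt0// ltr0n expn_gt0|exists U].
(* A bijection from nat to pairs merges the covers of all [F m] into a single sequence; the budgets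
   e / 2^(m+1) add up to e. *)
have /card_esym/ppcard_eqP[f] := card_nat2.
pose g ij := hausdorff_weight s (uncurry G ij).
have g0 ij : (0 <= g ij)%E by exact: hausdorff_weight_ge0.
exists (uncurry G \o f).
  split => [y /AF[m _ Fy]|k].
    have [k _ Gy] := (GP m).1.1 _ Fy.
    by exists (f^-1%FUN (m, k)) => //=; rewrite invK ?inE.
  by rewrite /= /uncurry; case: (f k) => i j; exact: (GP i).1.2.
have -> : (\sum_(0 <= k <oo) hausdorff_weight s ((uncurry G \o f) k) =
    \esum_(ij in setT) g ij)%E.
  rewrite nneseries_esumT; last by move=> n; exact: hausdorff_weight_ge0.
  by rewrite [RHS](reindex_esum setT _ f).
apply: (le_trans _ (epsilon_trick0 xpredT (ltW e0))).
have -> : (\esum_(ij in setT) g ij =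
    \sum_(0 <= i <oo) \sum_(0 <= j <oo) g (i, j))%E.
  rewrite nneseries_esumT; last by move=> i; exact: nneseries_ge0.
  under [RHS]eq_esum do rewrite nneseries_esumT//.
  rewrite esum_esum//; congr esum; last by apply/funext => -[].
  by apply/seteqP; split => // -[i j] _; exists i => //; exists j.
by apply: lee_nneseries => [i _ _|i _]; [exact: nneseries_ge0|exact: (GP i).2].
Qed.

End HausdorffNull.

(** * Criteria for the bounds ln 2 / ln 3 from above and from below *)

Section CantorDimension.
Context {R : realType}.
Implicit Types (A B U : set R) (s t d e D L : R).

Lemma ln2_gt0 : 0 < ln 2 :> R.
Proof. by rewrite ln_gt0// ltr1n. Qed.

Lemma ln3_gt0 : 0 < ln 3 :> R.
Proof. by rewrite ln_gt0// ltr1n. Qed.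

Definition cantor_dim : R := ln 2 / ln 3.

Lemma cantor_dim_gt0 : 0 < cantor_dim.
Proof. by rewrite divr_gt0// ?ln2_gt0// ln3_gt0. Qed.

Lemma powR3_cantor_dim : 3 `^ cantor_dim = 2 :> R.
Proof.
apply: ln_inj; rewrite ?posrE ?powR_gt0//.
by rewrite ln_powR /cantor_dim divfK// gt_eqF// ln3_gt0.
Qed.

Lemma powR_third_cantor_dim n : (3^-1 ^+ n) `^ cantor_dim = 2^-1 ^+ n :> R.
Proof.
have -> : (3^-1 ^+ n : R) = 3 `^ (- n%:R) by rewrite powRN powR_mulrn// exprVn.
by rewrite -powRrM mulrC powRrM powR3_cantor_dim powRN powR_mulrn// exprVn.
Qed.

(** A box-counting bound: 2^n pieces suffice at scale 3^-n. Indices from 2^n on are irrelevant to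
    covering. *)
Definition ternary_coverable D A := forall n, exists U : nat -> set R,
  (forall y, A y -> exists2 k, (k < 2 ^ n)%N & U k y) /\
  (forall k y z, U k y -> U k z -> `|y - z| <= D * 3^-1 ^+ n).

Lemma ternary_coverable_lipschitz D L A B (f : R -> R) : 0 <= L ->
  (forall y, A y -> B (f y)) ->
  (forall y z, A y -> A z -> `|y - z| <= L * `|f y - f z|) ->
  ternary_coverable D B -> ternary_coverable (L * D) A.
Proof.
move=> L0 AB fL BD n; have [U [cU dU]] := BD n.
exists (fun k => A `&` f @^-1` U k); split=> [y Ay|k y z [Ay Uy] [Az Uz]].
  by have [k kn Uk] := cU _ (AB _ Ay); exists k.
by rewrite (le_trans (fL _ _ Ay Az))// -mulrA ler_wpM2l// (dU k).
Qed.

(** The 2^n pieces weigh at most 2^n (D 3^-n)^s = D^s r^n in total, with r = 2 / 3^s < 1 because 2 =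
    3^[cantor_dim] < 3^s. *)
Lemma hausdorff_measure0_ternary D s A : 0 <= D -> cantor_dim < s ->
  ternary_coverable D A -> hausdorff_measure s A = 0%E.
Proof.
move=> D0 hs AD; apply/hausdorff_measure_eq0P => d e d0 e0.
have s0 : 0 < s := lt_trans cantor_dim_gt0 hs.
pose r : R := 2 * 3^-1 `^ s.
have r01 : 0 <= r < 1.
  rewrite /r mulr_ge0 ?powR_ge0//=.
  have -> : (3^-1 : R) = 3 `^ (- 1) by rewrite powR_inv1.
  rewrite -powRrM mulN1r powRN -/(_ / _) ltr_pdivrMr ?powR_gt0// mul1r.
  by rewrite -[ltLHS]powR3_cantor_dim /powR !gt_eqF// ltr_expR ltr_pM2r ?ln3_gt0.
(* [n1] brings the diameters below d and [n2] the total weight below e; both ratios are below 1, so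
   that [n1 + n2] serves both purposes. *)
have [n1 n1P] := geometric_lt D _ _ (third_bounds : 0 <= (3^-1 : R) < 1) d0.
have [n2 n2P] := geometric_lt (D `^ s) _ _ r01 e0.
have [U [cU dU]] := AD (n1 + n2)%N; set n := (n1 + n2)%N in cU dU.
have q0 m : 0 <= (3^-1 : R) ^+ m by rewrite exprn_ge0.
have dD k : (diam (U k) <= (D * 3^-1 ^+ n)%:E)%E.
  by apply: diam_le => [|y z]; [rewrite mulr_ge0|exact: dU].
(* Padding with empty sets, of weight 0, reduces the series to its first 2^n terms. *)
pose V k := if (k < 2 ^ n)%N then U k else set0.
exists V.
  split => [y /cU[k kn Uy]|k]; first by exists k => //; rewrite /V kn.
  rewrite /V; case: ifP => _; last first.
    by apply: diam_le => [|? ? []]; exact: ltW.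
  apply: (le_trans (dD k)); rewrite lee_fin (le_trans _ (ltW n1P))//.
  by rewrite ler_wpM2l// /n exprD ler_piMr// exprn_ile1// ltW ?(andP third_bounds).2.
rewrite (@nneseries_split _ _ 0 (2 ^ n)) ?add0n; last first.
  by move=> k _; exact: hausdorff_weight_ge0.
rewrite [X in (_ + X)%E]eseries0 ?adde0; last first.
  by move=> k nk _; rewrite /V ltnNge nk /= /hausdorff_weight eqxx.
apply: (@le_trans _ _ (\sum_(0 <= k < 2 ^ n) ((D * 3^-1 ^+ n) `^ s)%:E)%E).
  rewrite !big_nat; apply: lee_sum => k /= kn; rewrite /V kn.
  exact: hausdorff_weight_le (ltW s0) (dD k).
rewrite sumEFin lee_fin sumr_const_nat subn0 -[leLHS]mulr_natl natrX powRM//.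
have -> : (3^-1 ^+ n) `^ s = (3^-1 `^ s) ^+ n :> R.
  by rewrite -!powR_mulrn ?powR_ge0// -!powRrM mulrC.
rewrite mulrCA -exprMn -/r.
rewrite (le_trans _ (ltW n2P))// ler_wpM2l ?powR_ge0// /n exprD.
have /andP[r0 r1] := r01.
by rewrite ler_piMl ?exprn_ge0// exprn_ile1// ltW.
Qed.

(** At the separating rank n the binary distance is at most 2^-n = (3^-n)^[cantor_dim], and 3^-n is
    at most 6 times the ternary distance. *)
Lemma binary_expansion_holder L (f : (nat -> bool) -> R) w w' : 0 <= L ->
  `|expansion 3^-1 w - expansion 3^-1 w'| <= L * `|f w - f w'| ->
  `|expansion 2^-1 w - expansion 2^-1 w'| <= (6 * L * `|f w - f w'|) `^ cantor_dim.
Proof.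
move=> L0 fL; have [->|/eqP ww'] := eqVneq w w'.
  by rewrite subrr normr0 powR_ge0.
have [n [h3 /le_trans]] := @expansion_separation R _ _ ww'; apply.
rewrite -powR_third_cantor_dim; apply: ge0_ler_powR.
- exact: ltW cantor_dim_gt0.
- by rewrite nnegrE exprn_ge0.
- by rewrite nnegrE !mulr_ge0.
- by rewrite (le_trans h3)// -mulrA ler_pM2l.
Qed.

(* Mass distribution: through the code w, the binary expansion is a Hoelder
   function of exponent [cantor_dim] of f w, with range [0, 1]. A cover of A is
   thus sent to a cover of [0, 1] by intervals, whose lengths add up to at
   least 1. *)
Lemma cantor_dim_le L s A (f : (nat -> bool) -> R) : 0 <= L -> 0 <= s ->
  (forall w, A (f w)) ->
  (forall w w', `|expansion 3^-1 w - expansion 3^-1 w'| <= L * `|f w - f w'|) ->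
  hausdorff_measure s A = 0%E -> cantor_dim <= s.
Proof.
move=> L0 s0 Af fL /hausdorff_measure_eq0P A0; rewrite leNgt; apply/negP => sh.
pose C := (6 * L) `^ cantor_dim; have C0 : 0 <= C by exact: powR_ge0.
(* Scale 1 keeps diameters at most 1, so that lowering the exponent to s only increases powers. The
   intervals below have total length at most 2C / (4(C + 1)) < 1. *)
have [||U [AU dU] Ue] := A0 1 (4 * (C + 1))^-1; first by [].
  by rewrite invr_gt0; lra.
pose m k := fine (diam (U k)).
have mE k : diam (U k) = (m k)%:E.
  rewrite fineK// ge0_fin_numE ?diam_ge0//.
  exact: le_lt_trans (dU k) (ltry _).
have m01 k : 0 <= m k <= 1 by rewrite -!lee_fin -mE diam_ge0 dU.
have mW k : ((m k `^ cantor_dim)%:E <= hausdorff_weight s (U k))%E.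
  (* Diameter 0 is treated apart: for s = 0 the power 0^s is 1, but only nonnegativity of the weight
     is needed there. *)
  have /andP[] := m01 k; rewrite le_eqVlt => /predU1P[<- _|mk0 mk1].
    by rewrite powR0 ?gt_eqF ?cantor_dim_gt0// hausdorff_weight_ge0.
  rewrite /hausdorff_weight; case: ifPn => [/eqP Uk|_].
    have : (diam (U k) <= 0)%E by rewrite Uk; apply: diam_le.
    by rewrite mE lee_fin leNgt mk0.
  rewrite mE poweR_EFin lee_fin; apply: ger_powR; rewrite ?mk0//.
  exact: ltW.
pose r k := C * m k `^ cantor_dim.
have r0 k : 0 <= r k by rewrite mulr_ge0// powR_ge0.
(* The centre [a k] is the binary value of some code whose point lies in [U k], or 0 if there is
   none. *)
have [a aP] : {a : nat -> R &
    forall k w, U k (f w) -> `|expansion 2^-1 w - a k| <= r k}.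
  apply: (@choice _ _ (fun k a => forall w, U k (f w) ->
    `|expansion 2^-1 w - a| <= r k)) => k.
  have [[w0 Uw0]|Uk] := pselect (exists w, U k (f w)); last first.
    by exists 0 => w Uw; case: Uk; exists w.
  exists (expansion 2^-1 w0) => w Uw.
  have /andP[mk0 _] := m01 k.
  apply: (le_trans (binary_expansion_holder _ _ _ _ L0 (fL w w0))).
  rewrite /r /C -powRM ?mulr_ge0//; apply: ge0_ler_powR.
  - exact: ltW cantor_dim_gt0.
  - by rewrite nnegrE !mulr_ge0.
  - by rewrite nnegrE !mulr_ge0.
  - rewrite ler_wpM2l ?mulr_ge0// -lee_fin -mE.
    exact: dist_le_diam.
pose I k : set R := `[a k - r k, a k + r k]%classic.
have cI : `[0, 1]%classic `<=` \bigcup_k I k.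
  move=> y /=; rewrite in_itv /= => /expansion_binary_digits yE.
  have [k _ Uk] := AU _ (Af (binary_digits y)); exists k => //.
  by have := aP _ _ Uk; rewrite yE /I /= in_itv /= ler_distl.
have : (lebesgue_measure (`[0%R, 1%R]%classic : set R) <=
    \sum_(0 <= k <oo) lebesgue_measure (I k))%E.
  exact: (@measure_sigma_subadditive _ _ _ (@lebesgue_measure R) _ I
    (fun k => measurable_itv _) (measurable_itv _) cI).
apply/negP; rewrite -ltNge lebesgue_measure_itv /= lte_fin ltr01 sube0.
apply: (@le_lt_trans _ _
  (\sum_(0 <= k <oo) (2 * C)%:E * hausdorff_weight s (U k))%E).
  apply: lee_nneseries => // k _; rewrite /I lebesgue_measure_itv /= lte_fin.
  case: ifP => _; last first.
    by rewrite mule_ge0 ?hausdorff_weight_ge0// lee_fin mulr_ge0.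
  apply: le_trans (lee_wpmul2l _ (mW k)); last by rewrite lee_fin mulr_ge0.
  by rewrite -EFinD -EFinM lee_fin /r; lra.
rewrite nneseriesZl; last by move=> k _; exact: hausdorff_weight_ge0.
apply: (le_lt_trans (lee_wpmul2l _ Ue)); first by rewrite lee_fin mulr_ge0.
by rewrite -EFinM lte_fin ltr_pdivrMr; lra.
Qed.

Lemma hausdorff_dim_eq_cantor A :
  (forall s, cantor_dim < s -> hausdorff_measure s A = 0%E) ->
  (forall s, 0 <= s -> hausdorff_measure s A = 0%E -> cantor_dim <= s) ->
  hausdorff_dim A = cantor_dim%:E.
Proof.
move=> up low; apply/eqP; rewrite eq_le; apply/andP; split; last first.
  by apply: le_ereal_inf_tmp => _ [s [s0 As] <-]; rewrite lee_fin low.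
apply/lee_addgt0Pr => e e0; rewrite -EFinD; apply: ereal_inf_lbound.
exists (cantor_dim + e) => //; split; last by apply: up; rewrite ltrDl.
by rewrite addr_ge0// ltW// cantor_dim_gt0.
Qed.

End CantorDimension.

(** * Self-similar sets of the maps [ifs lambda] *)

Section TernaryCantorSets.
Context {R : realType}.
Implicit Types (K : set R) (lambda mu x y z c M : R) (w : nat -> bool).

Lemma ifs_dist lambda b y z :
  `|ifs lambda b y - ifs lambda b z| = 3^-1 * `|y - z|.
Proof.
rewrite -[X in X * _](@ger0_norm _ 3^-1)// -normrM.
by congr `|_|; rewrite /ifs; case: b; field.
Qed.

(** A point of K' is the image of a point of K' under n maps; the same maps send [k0] to a point of
    K within (M + |k0|) 3^-n of it. K' need not be closed, so the lemma also applies to the set of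
    all expansions. *)
Lemma self_similar_ge lambda K K' M : closed K -> K !=set0 ->
  (forall b y, K y -> K (ifs lambda b y)) ->
  (forall y, K' y -> `|y| <= M) ->
  (forall y, K' y -> exists b, exists2 z, K' z & ifs lambda b z = y) ->
  K' `<=` K.
Proof.
move=> cK [k0 Kk0] Kifs K'M K'ifs y K'y.
apply: (@closed_geometric _ K (M + `|k0|) 3^-1) => //; first exact: third_bounds.
move=> n; elim: n y K'y => [|n IH] y K'y.
  exists k0 => //; rewrite expr0 mulr1 (le_trans (ler_normB _ _))//.
  by rewrite lerD2r K'M.
have [b [z K'z <-]] := K'ifs y K'y.
have [k Kk zk] := IH z K'z.
exists (ifs lambda b k); first exact: Kifs.
by rewrite ifs_dist exprS mulrCA ler_pM2l.
Qed.

Lemma self_similar_bounded lambda K : is_self_similar_set (ifs lambda) K ->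
  exists2 M, 0 <= M & forall y, K y -> `|y| <= M.
Proof.
move=> [/compact_bounded [M [_ MP]] _ _].
exists (`|M| + 1); first by rewrite addr_ge0.
by apply: MP; rewrite ltr_pwDr// ler_norm.
Qed.

Lemma self_similar_expansion lambda K w : is_self_similar_set (ifs lambda) K ->
  K (lambda * expansion 3^-1 w).
Proof.
move=> [cK K0 KE].
suff sub : range (fun u => lambda * expansion 3^-1 u) `<=` K by apply: sub; exists w.
apply: (@self_similar_ge lambda _ _ `|lambda|) => //.
- by apply: compact_closed.
- by move=> b y Ky; rewrite KE; exists b => //; exists y.
- move=> _ [u _ <-]; rewrite normrM ler_piMr// ger0_norm.
    by have /andP[? ?] := @expansion_third R u; lra.
  by have /andP[] := @expansion_third R u.
- move=> _ [u _ <-]; exists (u 0%N).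
  exists (lambda * expansion 3^-1 (stail u)); first by exists (stail u).
  rewrite [in RHS](expansionE _ u third_bounds) /ifs.
  by case: (u 0%N) => /=; field.
Qed.

(** Multiplication by c intertwines [ifs lambda] and [ifs (c * lambda)]. *)
Lemma self_similar_scale c lambda K : is_self_similar_set (ifs lambda) K ->
  is_self_similar_set (ifs (c * lambda)) ( *%R c @` K).
Proof.
have ifsZ b y : ifs (c * lambda) b (c * y) = c * ifs lambda b y.
  by rewrite /ifs; case: b; field.
move=> [cK [k Kk] KE]; split.
- apply: continuous_compact => //; apply: continuous_subspaceT.
  exact: mulrl_continuous.
- by exists (c * k), k.
- apply/seteqP; split => [_ [y Ky <-]|_ [b _ [_ [y Ky <-] <-]]].
    move: Ky; rewrite [X in X y]KE => -[b _ [z Kz <-]].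
    by exists b => //; exists (c * z); [exists z|rewrite ifsZ].
  exists (ifs lambda b y); last by rewrite ifsZ.
  by rewrite [X in X _]KE; exists b => //; exists y.
Qed.

Lemma self_similar_unique lambda K K' : is_self_similar_set (ifs lambda) K ->
  is_self_similar_set (ifs lambda) K' -> K' `<=` K.
Proof.
move=> [cK K0 KE] K's; have [M _ MP] := self_similar_bounded _ _ K's.
move: K's => [_ _ K'E].
apply: (@self_similar_ge lambda _ _ M) => //; first exact: compact_closed.
  by move=> b y Ky; rewrite KE; exists b => //; exists y.
by move=> y; rewrite [X in X y]K'E => -[b _ [z K'z <-]]; exists b, z.
Qed.

Lemma self_similar_ternary_coverable lambda K :
  is_self_similar_set (ifs lambda) K ->
  exists2 D, 0 <= D & ternary_coverable D K.
Proof.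
move=> Ks; have [M M0 MP] := self_similar_bounded _ _ Ks.
move: Ks => [_ _ KE].
exists (M + M) => [|n]; first by rewrite addr_ge0.
elim: n => [|n [U [KU dU]]].
  exists (fun=> K); split => [y Ky|_ y z Ky Kz]; first by exists 0%N.
  by rewrite expr0 mulr1 (le_trans (ler_normB _ _))// lerD// MP.
(* The lowest bit of k selects the outermost map, and [k./2] encodes the remaining n maps. *)
exists (fun k => ifs lambda (odd k) @` U k./2); split.
  move=> y; rewrite [X in X y]KE => -[b _ [z Kz <-]].
  have [k kn Uk] := KU z Kz.
  exists (b + k.*2)%N.
    by rewrite expnS mul2n -ltn_half_double half_bit_double.
  by rewrite half_bit_double oddD odd_double addbF oddb; exists z.
move=> k _ _ [y Uy <-] [z Uz <-].
by rewrite ifs_dist exprS mulrCA ler_pM2l// (dU k./2).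
Qed.

(** Since [E lambda] contains x, it is not the default value [set0] of [xget]: a self-similar set
    exists for lambda, and scaling it by mu / lambda gives one for mu. *)
Lemma Lambda_self_similar x lambda mu : Lambda x lambda ->
  is_self_similar_set (ifs mu) (E mu).
Proof.
move=> [l0 Ex].
have [K Ks] : exists K, is_self_similar_set (ifs lambda) K.
  apply/not_existsP => h; move: Ex; rewrite /E /self_similar_set.
  by case: xgetP => // K _ /h.
apply: xgetPex; exists ( *%R (mu / lambda) @` K).
by have := self_similar_scale (mu / lambda) _ _ Ks; rewrite divfK// gt_eqF.
Qed.

Lemma inv_dist y z : y != 0 -> z != 0 -> `|y^-1 - z^-1| = `|y - z| / `|y * z|.
Proof.
move=> y0 z0; rewrite -normfV -normrM distrC; congr `|_|; field.
by rewrite ?y0 ?z0.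
Qed.

End TernaryCantorSets.

Theorem corollary3p3 (R : realType) (x lambda : R)
  (hx : 0 < x) (hlambda : Lambda x lambda) :
  hausdorff_dim (Lambda x) = hausdorff_dim (E lambda) /\
  hausdorff_dim (E lambda) = (ln 2 / ln 3)%:E.
Proof.
have l0 : 0 < lambda by case: hlambda.
have Es mu := @Lambda_self_similar _ x lambda mu hlambda.
suff [-> ->] : hausdorff_dim (E lambda) = cantor_dim%:E /\
  hausdorff_dim (Lambda x) = cantor_dim%:E by [].
split; apply: hausdorff_dim_eq_cantor => s s0.
- have [D D0] := self_similar_ternary_coverable _ _ (Es lambda).
  exact: hausdorff_measure0_ternary.
- apply: (@cantor_dim_le _ lambda^-1 _ _ (fun w => lambda * expansion 3^-1 w)) => //.
  + by rewrite invr_ge0 ltW.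
  + by move=> w; exact: self_similar_expansion.
  + by move=> w w'; rewrite -mulrBr normrM gtr0_norm// mulKf ?gt_eqF.
(* The distance of y and z is y z / x times that of x / y and x / z, so a Lipschitz constant, m^2 /
   x, is available only after cutting at m. *)
- apply: (@hausdorff_measure0_bigcup _ _ _
    (fun m => Lambda x `&` [set mu | mu <= m%:R])).
    move=> mu Lmu; exists (Num.truncn mu).+1 => //; split => //=.
    by apply/ltW; rewrite truncnS_gt.
  move=> m; have [D D0 DE] := self_similar_ternary_coverable _ _ (Es 1).
  have L0 : 0 <= m%:R ^+ 2 / x :> R by rewrite divr_ge0 ?exprn_ge0// ltW.
  apply: (@hausdorff_measure0_ternary _ (m%:R ^+ 2 / x * D)) => //.
    by rewrite mulr_ge0.
  apply: (@ternary_coverable_lipschitz _ D _ _ _ (fun mu => x / mu)) DE => //.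
    move=> mu [[mu0 Ex] _].
    (* Rescaling [E mu] by 1 / mu yields a self-similar set for [ifs 1], contained in [E 1] by
       uniqueness; it contains x / mu. *)
    apply: (@self_similar_unique _ _ _ ( *%R mu^-1 @` E mu) (Es 1)).
      have -> : 1 = mu^-1 * mu by rewrite mulVf// gt_eqF.
      exact: self_similar_scale.
    by exists x => //; rewrite mulrC.
  move=> y z [[y0 _] /= ym] [[z0 _] /= zm].
  rewrite -mulrBr normrM (gtr0_norm hx) mulrA divfK ?gt_eqF//.
  rewrite inv_dist ?gt_eqF// (@gtr0_norm _ (y * z)) ?mulr_gt0// mulrCA ler_peMr//.
  by rewrite ler_pdivlMr ?mulr_gt0// mul1r expr2 ler_pM// ltW.
(* A leading digit 1 keeps [t w] away from 0, so that x / [t w] is a point of [Lambda x] for every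
   code w. *)
- pose t w : R := expansion 3^-1 (scons true w).
  have tE w : t w = 3^-1 * (1 + expansion 3^-1 w).
    by rewrite /t expansion_scons//; exact: third_bounds.
  have t0 w : 0 < t w <= 1.
    by have /andP[? ?] := @expansion_third R w; rewrite tE; apply/andP; split; lra.
  (* The factor 3 undoes the shift by the leading digit, and 1 / x undoes the multiplication by x;
     inversion does not shrink distances on ]0, 1]. *)
  apply: (@cantor_dim_le _ (3 / x) _ _ (fun w => x / t w)) => //.
  + by rewrite divr_ge0// ltW.
  + move=> w; have /andP[tw0 tw1] := t0 w; split; first by rewrite divr_gt0.
    have := self_similar_expansion _ _ (scons true w) (Es (x / t w)).
    by rewrite -/(t w) divfK// gt_eqF.
  + move=> w w'; have /andP[tw0 tw1] := t0 w; have /andP[tw0' tw1'] := t0 w'.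
    rewrite -mulrBr normrM (gtr0_norm hx) mulrA divfK ?gt_eqF//.
    rewrite inv_dist ?gt_eqF// (@gtr0_norm _ (t w * t w')) ?mulr_gt0//.
    have -> : expansion 3^-1 w - expansion 3^-1 w' = 3 * (t w - t w').
      by rewrite !tE; field.
    rewrite normrM ger0_norm// ler_pM2l// ler_peMr//.
    by rewrite invf_ge1 ?mulr_gt0// mulr_ile1// ltW.
Qed.
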